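(* Let $d\ge2$ be a nonsquare integer, and let $(X_n,Y_n)$, $n\ge 0$, be the nonnegative solutions of $x^2-dy^2=1$. For an integer base $b\ge 2$ consider, for $n\ge1$, the two formulas $$X_n=\left\lfloor\frac{b^{n^2+2n}-X_1b^{n^2+n}}{b^{2n}-2X_1b^n+1}\right\rfloor\bmod b^n,\qquad (\mathrm{X})$$ $$Y_n=\left\lfloor\frac{Y_1b^{n^2+n}}{b^{2n}-2X_1b^n+1}\right\rfloor\bmod b^n.\qquad (\mathrm{Y})$$ The least admissible common base for (X) and (Y) is $$b_0=2X_1(X_1+1)-1.$$ Both formulas hold for all $n\ge1$ and all integers $b\ge b_0$. For every integer $b$ with $2X_1\le b<b_0$, the pair of formulas fails at $n=1$ (i.e. at least one of (X), (Y) is false for $n=1$).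
   Context: The fundamental solution $(X_1,Y_1)$ is the solution of $x^2-dy^2=1$ in positive integers with $X_1$ least, and $X_n+Y_n\sqrt d=(X_1+Y_1\sqrt d)^n$ for $n\ge0$. An integer base $b\ge2$ is called admissible if, for all $n\ge1$, the denominator $b^{2n}-2X_1b^n+1$ is positive and both formulas (X) and (Y) are correct. Here $u\bmod v$ denotes the remainder in $\{0,\dots,v-1\}$. *)

(* Defs.v *)
From HB Require Import structures.
From mathcomp Require Import all_boot all_order all_algebra all_field.

Set Implicit Arguments.
Unset Strict Implicit.
Unset Printing Implicit Defensive.

Import Order.TTheory GRing.Theory Num.Theory.
Local Open Scope ring_scope.

Definition nonsquare (d : int) : Prop := forall k : int, k ^+ 2 != d.

Definition pell_solution (d x y : int) : Prop := x ^+ 2 - d * y ^+ 2 = 1.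

Definition fundamental_solution (d x1 y1 : int) : Prop :=
  [/\ 0 < x1, 0 < y1, pell_solution d x1 y1 &
      forall x y : int, 0 < x -> 0 < y -> pell_solution d x y -> x1 <= x].

(* As d is not a square, the second clause determines X n and Y n from
   X 1 and Y 1; it is trivially true at n = 1. *)
Definition pell_sequence (d : int) (X Y : nat -> int) : Prop :=
  fundamental_solution d (X 1%N) (Y 1%N) /\
  forall n : nat,
    (X n)%:~R + (Y n)%:~R * sqrtC d%:~R
      = ((X 1%N)%:~R + (Y 1%N)%:~R * sqrtC d%:~R) ^+ n :> algC.

Definition denominator (X : nat -> int) (b : int) (n : nat) : int :=
  b ^+ (2 * n) - 2 * X 1%N * b ^+ n + 1.

(* The quotient is taken in rat, where x / 0 = 0. This value is never used when
   1 < b and 0 < n, since then denominator X b n is 1 modulo b. *)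
Definition formulaX (X : nat -> int) (b : int) (n : nat) : Prop :=
  X n = (Num.floor ((b ^+ (n ^ 2 + 2 * n) - X 1%N * b ^+ (n ^ 2 + n))%:~R
                      / (denominator X b n)%:~R : rat)
         %% b ^+ n)%Z.

Definition formulaY (X Y : nat -> int) (b : int) (n : nat) : Prop :=
  Y n = (Num.floor ((Y 1%N * b ^+ (n ^ 2 + n))%:~R
                      / (denominator X b n)%:~R : rat)
         %% b ^+ n)%Z.

Definition admissible (X Y : nat -> int) (b : int) : Prop :=
  2 <= b /\
  forall n : nat, (1 <= n)%N ->
    [/\ 0 < denominator X b n, formulaX X b n & formulaY X Y b n].

(* Main.v *)
Require Import Defs.
From HB Require Import structures.
From mathcomp Require Import all_boot all_order all_algebra all_field.
From mathcomp Require Import ring zify.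

Set Implicit Arguments.
Unset Strict Implicit.
Unset Printing Implicit Defensive.

Import Order.TTheory GRing.Theory Num.Theory.
Local Open Scope ring_scope.

(** Write A for X_1, t for b^n and D for t^2 - 2At + 1. Both X and Y satisfy
    u_(n+2) = 2A u_(n+1) - u_n, so their generating functions are rational with
    denominator 1 - 2Az + z^2. Evaluated at z = 1/t and scaled by t^n, they
    become the fractions of the two formulas, and truncating the series after
    the n-th term leaves an explicit remainder:
    fraction = (integer multiple of t) + u_n + (u_(n+1) t - u_n) / D.
    Hence, as soon as 0 <= u_n < t, the formula for u holds exactly when t
    divides the integer part of (u_(n+1) t - u_n) / D ([lucas_digitP]).

    For b >= b_0 that integer part is 0, because X_(n+1) + 2A <= b^n: at n = 1
    this reads 2A^2 - 1 + 2A <= b, which is b >= b_0, and since X grows by a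
    factor at most 2A <= b it persists for all n ([pell_small]).

    For 2A <= b < b_0 put s = b - 2A, so that D = sb + 1 at n = 1. The
    divisibility by b then forces u_2 = qD + r with 1 <= r <= s
    ([digit_residue]). One of the formulas alone can hold: the X-formula does
    for s = 1. If both hold, 2A^2 - 1 = qD + r and 2A Y_1 = q'D + r'. The
    identity A * (2A Y_1) = Y_1 * (2A^2 - 1) + Y_1 gives
    D (A q' - Y_1 q) = Y_1 (r + 1) - A r', whose right-hand side is smaller than
    D in absolute value; so A q' = Y_1 q. As A is coprime to Y_1, A divides q,
    and q > 0 because r <= s < 2A^2 - 1. Then qD >= A D > 2A^2, which is absurd
    ([no_common_residue]).

    A base below 2A is not admissible, because its denominator at n = 1 is
    b (b - 2A) + 1 <= 0; so b_0 is the least admissible base. *)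

(** * Reading a digit off a rational generating function *)

Lemma floor_intr_div (a D : int) :
  0 < D -> Num.floor (a%:~R / D%:~R : rat) = (a %/ D)%Z.
Proof.
move=> D0; apply: floor_def.
have D0' : 0 < D%:~R :> rat by rewrite ltr0z.
rewrite ler_pdivlMr // ltr_pdivrMr // -!intrM ler_int ltr_int.
by rewrite lez_floor ?gt_eqF // ltz_ceil.
Qed.

Definition lucas (A : int) (u : nat -> int) : Prop :=
  forall n, u n.+2 = 2 * A * u n.+1 - u n.

(** The truncated generating function, with m standing for the sum of
    u_k t^(n-1-k) over k < n: the left-hand side is t^n times the numerator of
    the full series, and u_(n+1) t - u_n is what the division by
    t^2 - 2At + 1 leaves after n + 1 terms. *)
Lemma lucas_expansion (A t : int) (u : nat -> int) (n : nat) : lucas A u ->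
  exists m, t ^+ n * (u 0%N * t ^+ 2 + (u 1%N - 2 * A * u 0%N) * t) =
    (m * t + u n) * (t ^+ 2 - 2 * A * t + 1) + (u n.+1 * t - u n).
Proof.
move=> hu; elim: n => [|n [m IH]]; first by exists 0; ring.
by exists (m * t + u n); rewrite exprS -mulrA IH hu; ring.
Qed.

(** Modulo t, the integer part of c / D is u_n plus the integer part of the
    remainder term of [lucas_expansion]; so the digit is right exactly when the
    carry produced by that remainder vanishes modulo t. This criterion is an
    equivalence, which serves both large and small bases. *)
Lemma lucas_digitP (A t c D : int) (u : nat -> int) (n : nat) :
  lucas A u -> D = t ^+ 2 - 2 * A * t + 1 -> 0 < D -> 0 <= u n < t ->
  c = t ^+ n * (u 0%N * t ^+ 2 + (u 1%N - 2 * A * u 0%N) * t) ->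
  u n = (Num.floor (c%:~R / D%:~R : rat) %% t)%Z <->
  (t %| (u n.+1 * t - u n) %/ D)%Z.
Proof.
move=> hu eD D0 un ->; have [m ->] := lucas_expansion t n hu.
rewrite -eD floor_intr_div // divzMDl ?gt_eqF // -addrA modzMDl.
set w := ((_ - _) %/ D)%Z.
have un_mod : u n = ((u n + 0) %% t)%Z by rewrite addr0 modz_small.
rewrite {1}un_mod; split => [/eqP | /dvdz_mod0P hw]; last first.
  by apply/eqP; rewrite eqz_modDl hw mod0z.
by rewrite eqz_modDl mod0z => /eqP hw; apply/dvdz_mod0P.
Qed.

(** With D = st + 1, a carry qt means qtD <= vt - u < (qt + 1)D, that is,
    u <= (v - qD) t < D + u. Since 0 < u < t and D = st + 1, the residue
    v - qD is confined to the short interval [1, s]. *)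
Lemma digit_residue (s t u v : int) : 0 <= s -> 0 < u < t ->
  (t %| (v * t - u) %/ (s * t + 1))%Z ->
  exists q r, v = q * (s * t + 1) + r /\ 1 <= r <= s.
Proof.
move=> s0 /andP[u0 ut] /dvdzP[q hq].
have D0 : 0 < s * t + 1 by nia.
have := lez_floor (v * t - u) (lt0r_neq0 D0).
have := ltz_ceil (v * t - u) D0.
rewrite hq => h1 h2; exists q, (v - q * (s * t + 1)); split; first by ring.
set r := v - _; have {}h2 : u <= r * t by rewrite /r; lia.
have {}h1 : r * t < s * t + 1 + u by rewrite /r; lia.
by apply/andP; split; nia.
Qed.

(** * The Pell recurrences *)

(** The irrationality of the square root of d, in a form without quotients:
    if q were nonzero, q^2 would divide p^2, hence q would divide p and d would
    be the square of p / q. *)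
Lemma square_of_ratio_square (d p q : int) :
  nonsquare d -> p ^+ 2 = d * q ^+ 2 -> q = 0.
Proof.
move=> hd h; apply/eqP/negP => /negP q0.
have /dvdzP[k hk] : (q %| p)%Z by rewrite -(@dvdz_pexp2r _ _ 2) // h dvdz_mull.
have /eqP[] := hd k; apply: (mulIf (expf_neq0 2 q0)).
by rewrite -h hk exprMn.
Qed.

Lemma sqrt_coord_inj (d a b a' b' : int) : nonsquare d ->
  a%:~R + b%:~R * sqrtC d%:~R = a'%:~R + b'%:~R * sqrtC d%:~R :> algC ->
  a = a' /\ b = b'.
Proof.
move=> hd h; have hbb : b' - b = 0.
  apply: (square_of_ratio_square hd (p := a - a')).
  apply: (@intr_inj algC); rewrite rmorphXn rmorphM rmorphXn /= !rmorphB /=.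
  rewrite -[d%:~R in RHS]sqrtCK -exprMn; congr (_ ^+ 2).
  (* Both sides are squares of (b' - b) times the root. *)
  rewrite -(addrK (b%:~R * sqrtC d%:~R) a%:~R) h; ring.
have ebb : b' = b by lia.
by move: h; rewrite ebb => /addIr/intr_inj.
Qed.

Lemma pell_norm1 d X Y : pell_sequence d X Y ->
  X 1%N ^+ 2 = d * Y 1%N ^+ 2 + 1.
Proof. by case=> -[_ _ + _] _; rewrite /pell_solution; lia. Qed.

Lemma pell_base_bounds d X Y : 2 <= d -> pell_sequence d X Y ->
  0 < Y 1%N < X 1%N.
Proof.
move=> hd hXY; have := pell_norm1 hXY; case: hXY => -[x0 y0 _ _] _ h.
by rewrite y0 /=; nia.
Qed.

Lemma pell0 d X Y : nonsquare d -> pell_sequence d X Y ->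
  X 0%N = 1 /\ Y 0%N = 0.
Proof.
move=> hsq [_ /(_ 0%N) h]; apply: (sqrt_coord_inj hsq).
by rewrite h expr0 mul0r addr0.
Qed.

Lemma pellS d X Y n : nonsquare d -> pell_sequence d X Y ->
  X n.+1 = X 1%N * X n + d * Y 1%N * Y n /\
  Y n.+1 = X 1%N * Y n + Y 1%N * X n.
Proof.
move=> hsq [_ h]; apply: (sqrt_coord_inj hsq).
rewrite h exprS -h !rmorphD !rmorphM /= -[d%:~R in X in _ = _ + X + _]sqrtCK.
ring.
Qed.

Lemma pell_lucas d X Y : nonsquare d -> pell_sequence d X Y ->
  lucas (X 1%N) X /\ lucas (X 1%N) Y.
Proof.
move=> hsq hXY; have h1 := pell_norm1 hXY.
(* The norm equation multiplied by m, so that linear arithmetic over monomials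
   suffices below. *)
have h2 m : X 1%N ^+ 2 * m = (d * Y 1%N ^+ 2 + 1) * m by rewrite h1.
split=> n; have [hX hY] := pellS n hsq hXY.
all: have [hX2 hY2] := pellS n.+1 hsq hXY.
  by rewrite hX2 hX hY; move: (h2 (X n)); lia.
by rewrite hY2 hX hY; move: (h2 (Y n)); lia.
Qed.

(** The order relations that keep the digits nonnegative and below the base.
    The bound Y_n <= X_n passes the recurrence because
    X_(n+1) - Y_(n+1) = (X_1 - Y_1)(X_n - Y_n) + (d - 1) Y_1 Y_n. *)
Lemma pell_growth d X Y n : 2 <= d -> nonsquare d -> pell_sequence d X Y ->
  [/\ 1 <= X n, 0 <= Y n <= X n, X n <= X n.+1 & Y n <= Y n.+1].
Proof.
move=> hd hsq hXY; have /andP[y0 yx] := pell_base_bounds hd hXY.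
have hn : 1 <= X n /\ 0 <= Y n <= X n.
  elim: n => [|n [x1 /andP[yn xn]]]; first by have [-> ->] := pell0 hsq hXY.
  have [-> ->] := pellS n hsq hXY.
  have : 0 <= (d - 1) * (Y 1%N * Y n) by rewrite !mulr_ge0 //; lia.
  by split; [|apply/andP; split]; nia.
have [-> ->] := pellS n hsq hXY; case: hn => x1 /andP[yn xn].
have : 0 <= d * (Y 1%N * Y n) by rewrite !mulr_ge0 //; lia.
by split=> //; try apply/andP; try split; nia.
Qed.

(** * The two formulas as divisibility conditions *)

Lemma denominatorE X b n :
  denominator X b n = (b ^+ n) ^+ 2 - 2 * X 1%N * b ^+ n + 1.
Proof. by rewrite /denominator mulnC exprM. Qed.

Lemma formulaXP d X Y b n : nonsquare d -> pell_sequence d X Y ->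
  0 < denominator X b n -> 0 <= X n < b ^+ n ->
  formulaX X b n <->
  (b ^+ n %| (X n.+1 * b ^+ n - X n) %/ denominator X b n)%Z.
Proof.
move=> hsq hXY D0 hX; have [hl _] := pell_lucas hsq hXY.
apply: (lucas_digitP hl (denominatorE X b n) D0 hX).
have [-> _] := pell0 hsq hXY.
by rewrite mul2n -addnn !exprD -mulnn exprM; ring.
Qed.

Lemma formulaYP d X Y b n : nonsquare d -> pell_sequence d X Y ->
  0 < denominator X b n -> 0 <= Y n < b ^+ n ->
  formulaY X Y b n <->
  (b ^+ n %| (Y n.+1 * b ^+ n - Y n) %/ denominator X b n)%Z.
Proof.
move=> hsq hXY D0 hY; have [_ hl] := pell_lucas hsq hXY.
apply: (lucas_digitP hl (denominatorE X b n) D0 hY).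
have [_ ->] := pell0 hsq hXY.
by rewrite exprD -mulnn exprM; ring.
Qed.

(** * Large bases *)

(** The condition X_(n+1) + 2A <= t makes X_(n+1) t - X_n smaller than
    t^2 - 2At + 1. The base b_0 is the one for which it is an equality at
    n = 1, since X_2 = 2A^2 - 1. *)
Lemma pell_small d X Y b n : 2 <= d -> nonsquare d -> pell_sequence d X Y ->
  2 * X 1%N * (X 1%N + 1) - 1 <= b -> (1 <= n)%N ->
  X n.+1 + 2 * X 1%N <= b ^+ n.
Proof.
move=> hd hsq hXY hb; have /andP[y0 yx] := pell_base_bounds hd hXY.
have [hl _] := pell_lucas hsq hXY; have [e0 _] := pell0 hsq hXY.
case: n => // n _; elim: n => [|n IH].
  by rewrite expr1 hl e0; nia.
have [xn _ _ _] := pell_growth n.+1 hd hsq hXY.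
rewrite hl exprS; apply: (@le_trans _ _ (2 * X 1%N * b ^+ n.+1)); first by nia.
by rewrite ler_wpM2r ?exprn_ge0; nia.
Qed.

Lemma formulas_large_base d X Y b n :
  2 <= d -> nonsquare d -> pell_sequence d X Y ->
  2 * X 1%N * (X 1%N + 1) - 1 <= b -> (1 <= n)%N ->
  [/\ 0 < denominator X b n, formulaX X b n & formulaY X Y b n].
Proof.
move=> hd hsq hXY hb n0; have ht := pell_small hd hsq hXY hb n0.
have /andP[y0 yx] := pell_base_bounds hd hXY.
have [x1 /andP[yn ynx] xS yS] := pell_growth n hd hsq hXY.
have [_ /andP[_ ySx] _ _] := pell_growth n.+1 hd hsq hXY.
have eD := denominatorE X b n.
have D0 : 0 < denominator X b n by rewrite eD; nia.
split=> //.
  apply/(formulaXP hsq hXY) => //; first by apply/andP; split; lia.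
  by rewrite divz_small ?dvdz0 // gtz0_abs // eD; apply/andP; split; nia.
apply/(formulaYP hsq hXY) => //; first by apply/andP; split; lia.
by rewrite divz_small ?dvdz0 // gtz0_abs // eD; apply/andP; split; nia.
Qed.

(** * Small bases *)

(** Here A and y are X_1 and Y_1, s is b - 2A, and 2A^2 - 1 and 2Ay are X_2 and
    Y_2. Their ratio is so close to A / y that quotients with small residues
    must satisfy A q' = y q exactly, which makes q a multiple of A: too large
    for q D <= 2A^2 - 2. *)
Lemma no_common_residue (d A y s D q r q' r' : int) :
  D = s * (2 * A + s) + 1 ->
  2 <= d -> 0 < y < A -> A ^+ 2 = d * y ^+ 2 + 1 ->
  s < 2 * A ^+ 2 - 1 ->
  2 * A ^+ 2 - 1 = q * D + r -> 1 <= r <= s ->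
  2 * A * y = q' * D + r' -> 1 <= r' <= s -> False.
Proof.
move=> eD hd /andP[y0 yA] hA hs hq /andP[r1 rs] hq' /andP[r1' rs'].
have [A0 s1] : 0 < A /\ 1 <= s by lia.
have D_gt : A * (s + s) < D by have := sqr_ge0 s; lia.
have A_le_As : A <= A * s by rewrite ler_peMr // ltW.
have D_gt0 : 0 < D by lia.
have proportional : D * (A * q' - y * q) = y * (r + 1) - A * r'.
  have := congr1 ( *%R^~ y) hq; have := congr1 ( *%R^~ A) hq' => /=.
  by clear; lia.
have eq_q : A * q' = y * q.
  have y_ge0 : 0 <= y * (r + 1) by rewrite mulr_ge0; lia.
  have y_le : y * (r + 1) <= A * (s + s) by apply: ler_pM; lia.
  have A_ge0 : 0 <= A * r' by rewrite mulr_ge0; lia.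
  have A_le : A * r' <= A * s by rewrite ler_wpM2l // ltW.
  have lt1 : A * q' - y * q < 1.
    by rewrite -(ltr_pM2l D_gt0) proportional; lia.
  have gtN1 : -1 < A * q' - y * q.
    by rewrite -(ltr_pM2l D_gt0) proportional; lia.
  by move: lt1 gtN1; clear; lia.
(* A Bezout relation between A and y, read off A^2 - d y^2 = 1. *)
have A_dvd : q = A * (A * q - d * y * q').
  have := congr1 ( *%R^~ q) hA; have := congr1 ( *%R (d * y)) eq_q => /=.
  by clear; lia.
(* The only use of b < b_0: it gives r <= s < 2A^2 - 1, so q D > 0. *)
have q_gt0 : 0 < q by rewrite -(pmulr_lgt0 _ D_gt0); lia.
have A_le_q : A <= q.
  rewrite A_dvd ler_peMr //; first by rewrite ltW.
  by rewrite -gtz0_ge1 -(pmulr_rgt0 _ A0) -A_dvd.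
have : A * D <= q * D by rewrite ler_wpM2r // ltW.
have : A * (A * (s + s)) <= A * D by rewrite ler_wpM2l // ltW.
have : A * A <= A * (A * s) by rewrite ler_wpM2l // ltW.
by move: hq r1; clear; lia.
Qed.

Lemma formulas_small_base d X Y b :
  2 <= d -> nonsquare d -> pell_sequence d X Y ->
  2 * X 1%N <= b -> b < 2 * X 1%N * (X 1%N + 1) - 1 ->
  ~ (formulaX X b 1%N /\ formulaY X Y b 1%N).
Proof.
move=> hd hsq hXY hb hb0.
have /andP[y0 yx] := pell_base_bounds hd hXY.
have [hlX hlY] := pell_lucas hsq hXY; have [eX0 eY0] := pell0 hsq hXY.
have eD : denominator X b 1 = (b - 2 * X 1%N) * b + 1.
  by rewrite denominatorE expr1; ring.
have D0 : 0 < denominator X b 1 by rewrite eD; nia.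
have s0 : 0 <= b - 2 * X 1%N by lia.
case=> /(formulaXP hsq hXY D0) hX /(formulaYP hsq hXY D0) hY.
move: hX hY; rewrite eD expr1.
case/(_ _)/(digit_residue s0); [by lia..|] => q [r [hq hr]].
case/(_ _)/(digit_residue s0); [by lia..|] => q' [r' [hq' hr']].
rewrite hlX eX0 in hq; rewrite hlY eY0 in hq'.
apply: (@no_common_residue d (X 1%N) (Y 1%N) (b - 2 * X 1%N)
  ((b - 2 * X 1%N) * b + 1) q r q' r') => //.
- by rewrite subrKC.
- by rewrite y0.
- exact: pell_norm1 hXY.
- by lia.
- by rewrite -hq; ring.
- by rewrite -hq'; ring.
Qed.

Theorem theorem19 (d : int) (X Y : nat -> int)
    (hd : 2 <= d) (hsq : nonsquare d) (hXY : pell_sequence d X Y) :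
  let b0 : int := 2 * X 1%N * (X 1%N + 1) - 1 in
  [/\ admissible X Y b0 /\ (forall b : int, admissible X Y b -> b0 <= b),
      forall (b : int) (n : nat), b0 <= b -> (1 <= n)%N ->
        formulaX X b n /\ formulaY X Y b n &
      forall b : int, 2 * X 1%N <= b -> b < b0 ->
        ~ (formulaX X b 1%N /\ formulaY X Y b 1%N)].
Proof.
move=> b0; have /andP[y0 yx] := pell_base_bounds hd hXY.
split; last 1 first.
- by move=> b hb hb0; apply: formulas_small_base hd hsq hXY hb hb0.
- split=> [|b [b2 /(_ 1%N isT)[D0 hX hY]]].
    by split=> [|n]; [rewrite /b0; nia | apply: formulas_large_base hd hsq hXY _].
  rewrite leNgt; apply/negP => hb.
  case: (formulas_small_base hd hsq hXY _ hb) => //.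
  by move: D0; rewrite denominatorE expr1; nia.
- by move=> b n hb n0; have [] := formulas_large_base hd hsq hXY hb n0.
Qed.
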